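(* Let $\ell$ be a field and let $R$ be a unital ultramatricial $\ell$-algebra. Then $$K_1(R)=R^\times/\{u(1):u\in(R[t])^\times,\ u(0)=1\},$$ that is, the set on the right is a normal subgroup of $R^\times$ and the canonical map $R^\times\to K_1(R)$ induces an isomorphism from the quotient onto $K_1(R)$.
   Context: A matricial $\ell$-algebra is a finite product of matrix algebras $M_k(\ell)$; an ultramatricial algebra is a countable increasing union of matricial algebras. $R^\times$ is the group of units of $R$, $R[t]$ is the polynomial ring with central indeterminate $t$, and $u(0),u(1)$ denote evaluations of $u\in R[t]$. $K_1(R)=GL(R)_{\mathrm{ab}}$. *)

(* Defs.v *)
From HB Require Import structures.
From mathcomp Require Import all_boot all_order all_algebra.
From mathcomp Require Import generic_quotient boolp.

Set Implicit Arguments.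
Unset Strict Implicit.
Unset Printing Implicit Defensive.

Import GRing.Theory.

Local Open Scope ring_scope.
Local Open Scope quotient_scope.

(* MathComp's {unit R} is restricted to finite rings, and the boolean predicate
   GRing.unit to rings with a chosen inverse function. *)
Section Units.
Variable R : pzRingType.

Definition inverse_pair (p : R * R) : bool :=
  (p.1 * p.2 == 1) && (p.2 * p.1 == 1).

Record units : Type := Units { unit_pair : R * R; _ : inverse_pair unit_pair }.

HB.instance Definition _ := [isSub for unit_pair].
HB.instance Definition _ := [Choice of units by <:].

Definition uval (u : units) : R := (unit_pair u).1.
Definition uinv (u : units) : R := (unit_pair u).2.

Lemma uvalV (u : units) : uval u * uinv u = 1.
Proof. by have /andP[/eqP] := valP u. Qed.

Lemma uVval (u : units) : uinv u * uval u = 1.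
Proof. by have /andP[_ /eqP] := valP u. Qed.

Lemma uval_inj : injective uval.
Proof.
move=> u v uv; apply/val_inj; rewrite [LHS]surjective_pairing.
rewrite [RHS]surjective_pairing -![(val _).1]/(uval _) -![(val _).2]/(uinv _) uv.
by rewrite -[uinv u]mulr1 -(uvalV v) -uv mulrA uVval mul1r.
Qed.

Definition mk_unit (x y : R) (xy : x * y = 1) (yx : y * x = 1) : units :=
  @Units (x, y) (introT andP (conj (introT eqP xy) (introT eqP yx))).

Definition unit1 : units := mk_unit (mulr1 1) (mulr1 1).
Definition unitV (u : units) : units := mk_unit (uVval u) (uvalV u).

Fact unitM_subproof (u v : units) :
  uval u * uval v * (uinv v * uinv u) = 1.
Proof. by rewrite mulrA -(mulrA (uval u)) uvalV mulr1 uvalV. Qed.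

Fact unitM_subproof' (u v : units) :
  uinv v * uinv u * (uval u * uval v) = 1.
Proof. by rewrite mulrA -(mulrA (uinv v)) uVval mulr1 uVval. Qed.

Definition unitM (u v : units) : units :=
  mk_unit (unitM_subproof u v) (unitM_subproof' u v).

Fact unitMA : associative unitM.
Proof. by move=> u v w; apply/uval_inj; rewrite /uval /= mulrA. Qed.
Fact unit1M : left_id unit1 unitM.
Proof. by move=> u; apply/uval_inj; rewrite /uval /= mul1r. Qed.
Fact unitM1 : right_id unit1 unitM.
Proof. by move=> u; apply/uval_inj; rewrite /uval /= mulr1. Qed.
Fact unitVM : left_inverse unit1 unitV unitM.
Proof. by move=> u; apply/uval_inj; rewrite /= -[RHS]/1 -(uVval u). Qed.
Fact unitMV : right_inverse unit1 unitV unitM.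
Proof. by move=> u; apply/uval_inj; rewrite /= -[RHS]/1 -(uvalV u). Qed.

HB.instance Definition _ :=
  isGroup.Build units unitMA unit1M unitM1 unitVM unitMV.

Lemma uval1 : uval 1%g = 1. Proof. by []. Qed.
Lemma uvalM (u v : units) : uval (u * v)%g = uval u * uval v.
Proof. by []. Qed.

End Units.

Section UnitMap.
Variables (R S : pzRingType) (f : R -> S).
Hypotheses (f1 : f 1 = 1) (fM : {morph f : x y / x * y}).

Fact unit_map_subproof (u : units R) : f (uval u) * f (uinv u) = 1.
Proof. by rewrite -fM uvalV. Qed.
Fact unit_map_subproof' (u : units R) : f (uinv u) * f (uval u) = 1.
Proof. by rewrite -fM uVval. Qed.
Definition unit_map (u : units R) : units S :=
  mk_unit (unit_map_subproof u) (unit_map_subproof' u).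

Lemma unit_mapM : {morph unit_map : u v / (u * v)%g}.
Proof. by move=> u v; apply/uval_inj; rewrite uvalM /= -fM. Qed.
Lemma unit_map1 : unit_map 1%g = 1%g.
Proof. by apply/uval_inj; rewrite uval1. Qed.

End UnitMap.

Definition normal_subgroup (G : groupType) (N : {pred G}) : Prop :=
  group_closed N /\ (forall x y : G, x \in N -> (x ^ y)%g \in N).

Section Quotient.
Variables (G : groupType) (N : {pred G}) (hN : normal_subgroup N).
Local Open Scope group_scope.

Definition quot_rel : rel G := fun x y => x^-1 * y \in N.

Fact quot_rel_refl : reflexive quot_rel.
Proof. by move=> x; rewrite /quot_rel mulVg; case: hN => -[]. Qed.

Fact quot_rel_sym : symmetric quot_rel.
Proof.
have h x y : quot_rel x y -> quot_rel y x.
  by move=> /(group_closedV hN.1); rewrite /quot_rel invgM invgK.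
by move=> x y; apply/idP/idP; apply: h.
Qed.

Fact quot_rel_trans : transitive quot_rel.
Proof.
move=> y x z xy yz; have := group_closedM hN.1 xy yz.
by rewrite /quot_rel mulgA mulgK.
Qed.

Canonical quot_equiv :=
  EquivRel quot_rel quot_rel_refl quot_rel_sym quot_rel_trans.

(* The proof hN only matters through N: it is an argument so that the type
   below is recognized as a group. *)
Definition quot_group : Type := {eq_quot quot_equiv}.

HB.instance Definition _ := Choice.on quot_group.
HB.instance Definition _ := Quotient.on quot_group.

Definition quot_proj (x : G) : quot_group := \pi_quot_group x.

Lemma quot_projP (x y : G) : reflect (quot_proj x = quot_proj y) (x^-1 * y \in N).
Proof. by apply: (iffP idP) => [xy|/eqmodP//]; apply/eqmodP. Qed.

Lemma quot_proj_repr (a : quot_group) : quot_proj (repr a) = a.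
Proof. exact: reprK. Qed.

Definition quot1 : quot_group := quot_proj 1.
Definition quotV (a : quot_group) : quot_group := quot_proj (repr a)^-1.
Definition quotM (a b : quot_group) : quot_group := quot_proj (repr a * repr b).

Lemma quotM_proj (x y : G) : quotM (quot_proj x) (quot_proj y) = quot_proj (x * y).
Proof.
apply/quot_projP; set x' := repr _; set y' := repr _.
have /quot_projP xx' : quot_proj x' = quot_proj x by rewrite quot_proj_repr.
have /quot_projP yy' : quot_proj y' = quot_proj y by rewrite quot_proj_repr.
have -> : (x' * y')^-1 * (x * y) = (x'^-1 * x) ^ y' * (y'^-1 * y).
  by rewrite conjgE invgM !mulgA mulgK.
exact: (group_closedM hN.1 (hN.2 _ _ xx') yy').
Qed.

Lemma quotV_proj (x : G) : quotV (quot_proj x) = quot_proj x^-1.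
Proof.
apply/quot_projP; set x' := repr _.
have /quot_projP xx' : quot_proj x = quot_proj x' by rewrite quot_proj_repr.
have /(hN.2 _ x^-1) : x^-1 * x' \in N by [].
by rewrite conjgE !mulgA !invgK mulgV mul1g.
Qed.

Fact quotMA : associative quotM.
Proof.
move=> a b c; rewrite -(quot_proj_repr a) -(quot_proj_repr b) -(quot_proj_repr c).
by rewrite !quotM_proj mulgA.
Qed.
Fact quot1M : left_id quot1 quotM.
Proof. by move=> a; rewrite -(quot_proj_repr a) quotM_proj mul1g. Qed.
Fact quotM1 : right_id quot1 quotM.
Proof. by move=> a; rewrite -(quot_proj_repr a) quotM_proj mulg1. Qed.
Fact quotVM : left_inverse quot1 quotV quotM.
Proof. by move=> a; rewrite -(quot_proj_repr a) quotV_proj quotM_proj mulVg. Qed.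
Fact quotMV : right_inverse quot1 quotV quotM.
Proof. by move=> a; rewrite -(quot_proj_repr a) quotV_proj quotM_proj mulgV. Qed.

HB.instance Definition _ :=
  isGroup.Build quot_group quotMA quot1M quotM1 quotVM quotMV.

Fact quot_projM : {morph quot_proj : x y / x * y}.
Proof. by move=> x y; rewrite -quotM_proj. Qed.

HB.instance Definition _ := isMultiplicative.Build G quot_group quot_proj quot_projM.

End Quotient.

Section Abelianization.
Variable G : groupType.
Local Open Scope group_scope.

Definition commutator_subgroup : {pred G} :=
  [pred x | `[< forall H : {pred G}, group_closed H ->
                  (forall a b, [~ a, b] \in H) -> x \in H >]].

Fact commutator_subgroup_normal : normal_subgroup commutator_subgroup.
Proof.
split; first split.
- by apply/asboolP => H [].
- move=> x y /asboolP xD /asboolP yD; apply/asboolP => H gH cH.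
  exact: gH.2 (xD _ gH cH) (yD _ gH cH).
- move=> x y /asboolP xD; apply/asboolP => H gH cH.
  rewrite -[x ^ y](mulVKg x) -commgEl.
  exact: (group_closedM gH (xD _ gH cH) (cH _ _)).
Qed.

Definition abelianization : groupType := quot_group commutator_subgroup_normal.

Definition to_ab (x : G) : abelianization :=
  quot_proj commutator_subgroup_normal x.

Lemma abelianizationC (a b : abelianization) : a * b = b * a.
Proof.
rewrite -[a]quot_proj_repr -[b]quot_proj_repr -!quot_projM.
apply/quot_projP; rewrite invgM.
have -> (x y : G) : y^-1 * x^-1 * (y * x) = [~ y, x].
  by rewrite /commg conjgE !mulgA.
by apply/asboolP => H _; apply.
Qed.

End Abelianization.

Section StableGL.
Variable R : pzRingType.

Definition GLn (n : nat) : groupType := units 'M[R]_n.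

(* For m <= n, the block matrix diag(A, 1) (cf. stab_block); the value is
   irrelevant otherwise. *)
Definition stab (m n : nat) (A : 'M[R]_m) : 'M[R]_n :=
  pid_mx m *m A *m pid_mx m + copid_mx m.


Lemma stab_block (m k : nat) (A : 'M[R]_m) :
  stab (m + k) A = block_mx A 0 0 1%:M.
Proof.
rewrite /stab /copid_mx pid_mx_col pid_mx_row mul_col_mx mul1mx mul0mx.
rewrite mul_col_mx mul_mx_row mulmx1 mulmx0 mul0mx pid_mx_block.
have -> : 1%:M - block_mx 1%:M 0 0 0 = block_mx 0 0 0 1%:M :> 'M[R]_(m + k).
  by rewrite scalar_mx_block opp_block_mx add_block_mx !oppr0 !addr0 subrr.
by rewrite -row_mx0 -/(block_mx A 0 0 0) add_block_mx !addr0 !add0r.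
Qed.

Lemma stab_id (m : nat) (A : 'M[R]_m) : stab m A = A.
Proof. by rewrite /stab /copid_mx pid_mx_1 mul1mx mulmx1 subrr addr0. Qed.

Lemma stab_comp (m n p : nat) (A : 'M[R]_m) :
  (m <= n)%N -> (n <= p)%N -> stab p (stab n A) = stab p A.
Proof.
move=> mn np; rewrite /stab /copid_mx mulmxDr mulmxDl mulmxBr mulmxBl mulmx1.
rewrite !mulmxA !mul_pid_mx -!mulmxA !mul_pid_mx !minnn.
rewrite !(minn_idPl mn) !(minn_idPr mn) !(minn_idPl mn) mulmxA -addrA.
by congr (_ + _); rewrite (minn_idPr mn) addrC addrA subrK.
Qed.

Lemma stab1 (m n : nat) : (m <= n)%N -> stab n (1 : 'M[R]_m) = 1.
Proof.
by move=> mn; rewrite /stab mulmx1 pid_mx_id // /copid_mx addrC subrK.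
Qed.

Lemma stabM (m n : nat) : (m <= n)%N ->
  {morph @stab m n : A B / A * B >-> A * B}.
Proof.
move=> mn A B; rewrite /stab; set P := pid_mx m; set Q := pid_mx m.
set c := copid_mx m.
have QP : Q *m P = 1%:M by rewrite pid_mx_id // pid_mx_1.
have Qc : Q *m c = 0 by exact: mul_pid_mx_copid.
have cP : c *m P = 0 by exact: mul_copid_mx_pid.
have cc : c *m c = c by exact: copid_mx_id.
clearbody c P Q; rewrite -[RHS]/(_ *m _) mulmxDl !mulmxDr cc -[P *m A *m Q *m c]mulmxA Qc.
rewrite mulmx0 addr0 !mulmxA cP !mul0mx add0r -[P *m A *m Q *m P]mulmxA QP.
by rewrite mulmx1.
Qed.

Definition GLstab (m n : nat) (mn : (m <= n)%N) : GLn m -> GLn n :=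
  unit_map (stab1 mn) (stabM mn).

Lemma uval_GLstab (m n : nat) (mn : (m <= n)%N) (A : GLn m) :
  uval (GLstab mn A) = stab n (uval A).
Proof. by []. Qed.

Definition preGL : Type := {n : nat & GLn n}.
HB.instance Definition _ := Choice.on preGL.

(* GL is the direct limit of the groups GL_n along A |-> diag(A, 1): pairs
   (n, A) and (m, B) are identified when they agree in some larger GL_N. *)
Definition GL_rel : rel preGL := fun a b =>
  `[< exists N (ha : (tag a <= N)%N) (hb : (tag b <= N)%N),
        GLstab ha (tagged a) = GLstab hb (tagged b) >].

Lemma GL_relP (a b : preGL) : reflect
  (exists N, [/\ (tag a <= N)%N, (tag b <= N)%N &
                 stab N (uval (tagged a)) = stab N (uval (tagged b))])
  (GL_rel a b).
Proof.
apply: (iffP (asboolP _)) => [[N [ha [hb]]]|[N [ha hb e]]].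
  by move/(congr1 (@uval _)); rewrite !uval_GLstab; exists N.
by exists N, ha, hb; apply/uval_inj; rewrite !uval_GLstab.
Qed.

Fact GL_rel_refl : reflexive GL_rel.
Proof. by move=> a; apply/GL_relP; exists (tag a). Qed.

Fact GL_rel_sym : symmetric GL_rel.
Proof.
by move=> a b; apply/GL_relP/GL_relP => -[N [? ? ?]]; exists N.
Qed.

Fact GL_rel_trans : transitive GL_rel.
Proof.
move=> b a c /GL_relP[N [aN bN ab]] /GL_relP[M [bM cM bc]].
have NK := leq_maxl N M; have MK := leq_maxr N M.
apply/GL_relP; exists (maxn N M); split.
- exact: leq_trans NK.
- exact: leq_trans MK.
by rewrite -(stab_comp _ aN NK) ab stab_comp // -(stab_comp _ bM MK) bc stab_comp.
Qed.

Canonical GL_equiv := EquivRel GL_rel GL_rel_refl GL_rel_sym GL_rel_trans.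

Definition GL : Type := {eq_quot GL_equiv}.
HB.instance Definition _ := Choice.on GL.
HB.instance Definition _ := Quotient.on GL.

Definition to_GL (n : nat) (A : GLn n) : GL :=
  \pi_GL (Tagged GLn A : preGL).

Lemma to_GLP (m n : nat) (A : GLn m) (B : GLn n) :
  to_GL A = to_GL B <->
  exists N, [/\ (m <= N)%N, (n <= N)%N & stab N (uval A) = stab N (uval B)].
Proof.
by split=> [/eqmodP/GL_relP //|h]; apply/eqmodP/GL_relP.
Qed.

Lemma to_GL_stab (m n : nat) (mn : (m <= n)%N) (A : GLn m) :
  to_GL (GLstab mn A) = to_GL A.
Proof.
by apply/to_GLP; exists n; rewrite uval_GLstab stab_comp.
Qed.

Lemma to_GL_repr (x : GL) : to_GL (tagged (repr x)) = x.
Proof. by rewrite /to_GL taggedK reprK. Qed.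

Definition preGLM (a b : preGL) : preGL :=
  Tagged GLn (GLstab (leq_maxl (tag a) (tag b)) (tagged a) *
              GLstab (leq_maxr (tag a) (tag b)) (tagged b))%g.

Definition GL1 : GL := to_GL (1%g : GLn 0).
Definition GLV (x : GL) : GL := to_GL (tagged (repr x))^-1%g.
Definition GLM (x y : GL) : GL := \pi_GL (preGLM (repr x) (repr y)).

Lemma GLM_to_GL (n : nat) (A B : GLn n) :
  GLM (to_GL A) (to_GL B) = to_GL (A * B)%g.
Proof.
have := to_GL_repr (to_GL A); have := to_GL_repr (to_GL B); rewrite /GLM.
case: (repr (to_GL A)) (repr (to_GL B)) => [m A'] [p B'] /=.
move=> /to_GLP[N [pN nN eB]] /to_GLP[M [mM nM eA]].
have NK := leq_maxl N M; have MK := leq_maxr N M; set K := maxn N M in NK MK.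
have eB' : stab K (uval B') = stab K (uval B).
  by rewrite -(stab_comp _ pN NK) eB stab_comp.
have eA' : stab K (uval A') = stab K (uval A).
  by rewrite -(stab_comp _ mM MK) eA stab_comp.
have mK := leq_trans mM MK; have pK := leq_trans pN NK.
have nK := leq_trans nN NK.
apply/to_GLP; exists K; split=> //; first by rewrite geq_max mK.
rewrite !uvalM !stabM ?geq_max ?mK //= !uval_GLstab.
by rewrite !stab_comp ?leq_maxl ?leq_maxr ?geq_max ?mK // eA' eB'.
Qed.

Lemma to_GL1 (n : nat) : to_GL (1%g : GLn n) = GL1.
Proof.
apply/to_GLP; exists n; split=> //.
by rewrite !uval1 !stab1.
Qed.

Lemma GL_lift (x : GL) (n : nat) :
  (tag (repr x) <= n)%N -> exists A : GLn n, x = to_GL A.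
Proof.
move=> le_n; exists (GLstab le_n (tagged (repr x))).
by rewrite to_GL_stab to_GL_repr.
Qed.

Lemma GLV_to_GL (n : nat) (A : GLn n) : GLV (to_GL A) = to_GL A^-1%g.
Proof.
have := to_GL_repr (to_GL A); rewrite /GLV.
case: (repr (to_GL A)) => [m A'] /= /to_GLP[N [mN nN eA]].
have e : GLstab mN A' = GLstab nN A by apply/uval_inj.
apply/to_GLP; exists N; split=> //.
have hV k (kN : (k <= N)%N) (C : GLn k) : GLstab kN C^-1%g = (GLstab kN C)^-1%g.
  by apply/uval_inj.
by rewrite -!uval_GLstab !hV e.
Qed.

Fact GLMA : associative GLM.
Proof.
move=> x y z; pose r (t : GL) := tag (repr t).
pose n := maxn (r x) (maxn (r y) (r z)).
have [A ->] : exists A : GLn n, x = to_GL A.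
  by apply: GL_lift; rewrite leq_maxl.
have [B ->] : exists B : GLn n, y = to_GL B.
  by apply: GL_lift; rewrite !leq_max leqnn orbT.
have [C ->] : exists C : GLn n, z = to_GL C.
  by apply: GL_lift; rewrite !leq_max leqnn !orbT.
by rewrite !GLM_to_GL mulgA.
Qed.
Fact GL1M : left_id GL1 GLM.
Proof.
move=> x; have [A ->] := GL_lift (leqnn (tag (repr x))).
by rewrite -(to_GL1 (tag (repr x))) GLM_to_GL mul1g.
Qed.
Fact GLM1 : right_id GL1 GLM.
Proof.
move=> x; have [A ->] := GL_lift (leqnn (tag (repr x))).
by rewrite -(to_GL1 (tag (repr x))) GLM_to_GL mulg1.
Qed.
Fact GLVM : left_inverse GL1 GLV GLM.
Proof.
move=> x; have [A ->] := GL_lift (leqnn (tag (repr x))).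
by rewrite GLV_to_GL GLM_to_GL mulVg to_GL1.
Qed.
Fact GLMV : right_inverse GL1 GLV GLM.
Proof.
move=> x; have [A ->] := GL_lift (leqnn (tag (repr x))).
by rewrite GLV_to_GL GLM_to_GL mulgV to_GL1.
Qed.

HB.instance Definition _ := isGroup.Build GL GLMA GL1M GLM1 GLVM GLMV.

Fact to_GL_morph (n : nat) : {morph @to_GL n : A B / (A * B)%g}.
Proof. by move=> A B; rewrite -GLM_to_GL. Qed.

HB.instance Definition _ (n : nat) :=
  isMultiplicative.Build (GLn n) GL (@to_GL n) (@to_GL_morph n).

Definition unit_GL1 : units R -> GLn 1 :=
  unit_map (f := fun x : R => x%:M : 'M[R]_1) (erefl _) (@scalar_mxM _ 1).

Definition K1 : groupType := abelianization GL.

Definition unit_K1 (x : units R) : K1 := to_ab (to_GL (unit_GL1 x)).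

End StableGL.

Section Ultramatricial.
Variable F : fieldType.

Section MatricialAlgebra.
Variables (m : nat) (k : 'I_m -> nat).

(* Sizes are successors because M_k(F) is meant for k >= 1; m = 0 gives the
   zero algebra. *)
Definition matricial : Type := {dffun forall i : 'I_m, 'M[F]_((k i).+1)}.
HB.instance Definition _ := Choice.on matricial.

Definition matr0 : matricial := [ffun i => 0].
Definition matr1 : matricial := [ffun i => 1].
Definition matrN (a : matricial) : matricial := [ffun i => - a i].
Definition matrD (a b : matricial) : matricial := [ffun i => a i + b i].
Definition matrM (a b : matricial) : matricial := [ffun i => a i * b i].
Definition matrZ (c : F) (a : matricial) : matricial := [ffun i => c *: a i].

Fact matrDA : associative matrD.
Proof. by move=> a b c; apply/ffunP=> i; rewrite !ffunE addrA. Qed.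
Fact matrDC : commutative matrD.
Proof. by move=> a b; apply/ffunP=> i; rewrite !ffunE addrC. Qed.
Fact matr0D : left_id matr0 matrD.
Proof. by move=> a; apply/ffunP=> i; rewrite !ffunE add0r. Qed.
Fact matrND : left_inverse matr0 matrN matrD.
Proof. by move=> a; apply/ffunP=> i; rewrite !ffunE addNr. Qed.

HB.instance Definition _ :=
  GRing.isZmodule.Build matricial matrDA matrDC matr0D matrND.

Fact matrMA : associative matrM.
Proof. by move=> a b c; apply/ffunP=> i; rewrite !ffunE mulrA. Qed.
Fact matr1M : left_id matr1 matrM.
Proof. by move=> a; apply/ffunP=> i; rewrite !ffunE mul1r. Qed.
Fact matrM1 : right_id matr1 matrM.
Proof. by move=> a; apply/ffunP=> i; rewrite !ffunE mulr1. Qed.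
Fact matrMDl : left_distributive matrM matrD.
Proof. by move=> a b c; apply/ffunP=> i; rewrite !ffunE mulrDl. Qed.
Fact matrMDr : right_distributive matrM matrD.
Proof. by move=> a b c; apply/ffunP=> i; rewrite !ffunE mulrDr. Qed.

HB.instance Definition _ := GRing.Zmodule_isPzRing.Build matricial
  matrMA matr1M matrM1 matrMDl matrMDr.

Fact matrZA (c d : F) (a : matricial) :
  matrZ c (matrZ d a) = matrZ (c * d) a.
Proof. by apply/ffunP=> i; rewrite !ffunE scalerA. Qed.
Fact matrZ1 : left_id 1 matrZ.
Proof. by move=> a; apply/ffunP=> i; rewrite !ffunE scale1r. Qed.
Fact matrZDr : right_distributive matrZ +%R.
Proof. by move=> c a b; apply/ffunP=> i; rewrite !ffunE scalerDr. Qed.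
Fact matrZDl (a : matricial) : {morph matrZ^~ a : c d / c + d}.
Proof. by move=> c d; apply/ffunP=> i; rewrite !ffunE scalerDl. Qed.

HB.instance Definition _ := GRing.Zmodule_isLmodule.Build F matricial
  matrZA matrZ1 matrZDr matrZDl.

End MatricialAlgebra.

Variable R : algType F.

(* The identity of a matricial subalgebra need not be that of R. *)
Definition matricial_subalgebra (S : R -> Prop) : Prop :=
  exists (m : nat) (k : 'I_m -> nat) (f : {linear matricial k -> R}),
    [/\ {morph f : a b / a * b}, injective f &
        forall x : R, S x <-> exists a, f a = x].

Definition ultramatricial : Prop :=
  exists S : nat -> R -> Prop,
    [/\ forall n, matricial_subalgebra (S n),
        forall n x, S n x -> S n.+1 x &
        forall x, exists n, S n x].

End Ultramatricial.

(* As 0 and 1 are central, horner evaluation at them is a ring morphism even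
   when R is not commutative. *)
Definition homotopic_to_1 (R : nzRingType) : {pred units R} :=
  [pred x | `[< exists u : units {poly R},
                  (uval u).[0] = 1 /\ (uval u).[1] = uval x >]].

(* Main.v *)
Require Import Defs.
From mathcomp Require Import all_boot all_order all_algebra.
From HB Require Import structures.
From mathcomp Require Import generic_quotient boolp.

(** The group on the right-hand side is identified with the image of K_1 by
    showing that [homotopic_to_1 R] is exactly the kernel of
    R^x -> K_1(R) (lemma [homotopic_to_1_K1]) and that this map is onto
    (lemma [unit_K1_surj]); normality and the isomorphism are then formal.

    Once a stage of the union contains 1, its unit is that of R, so R is an
    increasing union of unital copies of S = prod_i M_{k_i}(F).  A matrix over
    such an S has one determinant for each factor, because
    M_n(M_k(F)) = M_{nk}(F); call it special when all these determinants are 1.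
    Everything passes through the equivalence of three properties of a unit x
    of R: x is special over some stage, x is trivial in K_1(R), x is homotopic
    to 1.

    - The bridge from determinants to factorizations is Gaussian elimination:
      SL_N(F) is generated by the matrices 1 + b c with c b = 0, where b is a
      column and c a row ([SL_transvection_prod]).  Such generators exist over
      any ring, and a special matrix over S is a product of them
      ([SL_matricial_transvection_prod]).
    - When c b = 0, diag(1 + b c, 1) is a single commutator of block triangular
      matrices, so special matrices die in K_1 ([K1_transvection]).
      Writing transvections as commutators inside SL_{k_i}(F) would fail for
      k_i = 2 and F = F_2.
    - When c b = 0, t |-> 1 + t b c is a path of units from 1 to 1 + b c, so
      special units are homotopic to 1.
    - Conversely, the elements of GL(R) that are special over all large stages
      form a subgroup, and it contains the commutators; so an element that
      dies in K_1 is special ([K1_special_over]).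
    - Finally a unit u of R[t] has its coefficients, and those of its inverse,
      in some S, and becomes there an invertible matrix over F[t] for each
      factor.  Its determinant is a unit of F[t], hence constant, so u(0) = 1
      forces u(1) to be special ([homotopic_special_over]).

    For surjectivity, an invertible matrix over S differs by a special one from
    the unit of S whose factors are diag(d_i, 1, ..., 1), where the d_i are the
    determinants. *)

Set Implicit Arguments.
Unset Strict Implicit.
Unset Printing Implicit Defensive.

Import GRing.Theory.
Local Open Scope ring_scope.

(** * Products of transvections *)

(** The number of factors is recorded so that factorizations over the different
    factors of a matricial algebra can be brought to a common length and
    performed simultaneously. *)
Fixpoint transvection_prod (R : pzRingType) (n L : nat) (A : 'M[R]_n) : Prop :=
  if L is L'.+1 then
    exists (b : 'cV[R]_n) (c : 'rV[R]_n) (A' : 'M[R]_n),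
      [/\ c *m b = 0, A = (1%:M + b *m c) *m A' & transvection_prod L' A']
  else A = 1%:M.

Section TransvectionProd.
Variable R : pzRingType.
Implicit Types n L : nat.

Lemma transvection_prodS n L (A : 'M[R]_n) :
  transvection_prod L A -> transvection_prod L.+1 A.
Proof.
by move=> tA; exists 0, 0, A; rewrite !mulmx0 addr0 mul1mx.
Qed.

Lemma transvection_prod_leq n L K (A : 'M[R]_n) :
  (L <= K)%N -> transvection_prod L A -> transvection_prod K A.
Proof.
elim: K => [|K IH]; first by rewrite leqn0 => /eqP ->.
rewrite leq_eqVlt => /predU1P[-> //|LK tA].
exact/transvection_prodS/IH.
Qed.

Lemma transvection_prodM n L K (A B : 'M[R]_n) :
  transvection_prod L A -> transvection_prod K B ->
  transvection_prod (L + K) (A *m B).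
Proof.
elim: L A => [|L IH] A /=; first by move->; rewrite mul1mx.
move=> [b [c [A' [cb -> tA']]]] tB; exists b, c, (A' *m B); split=> //.
  by rewrite mulmxA.
exact: IH.
Qed.

Lemma transvection_prod1 n (b : 'cV[R]_n) (c : 'rV[R]_n) :
  c *m b = 0 -> transvection_prod 1 (1%:M + b *m c).
Proof. by move=> cb; exists b, c, 1%:M; rewrite mulmx1. Qed.

Lemma transvectionVl m n (b : 'M[R]_(m, n)) (c : 'M[R]_(n, m)) :
  c *m b = 0 -> (1%:M - b *m c) *m (1%:M + b *m c) = 1%:M.
Proof.
move=> cb; rewrite mulmxDr mulmx1 mulmxBl mul1mx -mulmxA (mulmxA c) cb.
by rewrite mul0mx mulmx0 subr0 subrK.
Qed.

Lemma transvectionVr m n (b : 'M[R]_(m, n)) (c : 'M[R]_(n, m)) :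
  c *m b = 0 -> (1%:M + b *m c) *m (1%:M - b *m c) = 1%:M.
Proof.
move=> cb; have := @transvectionVl m n (- b) c.
by rewrite mulmxN cb oppr0 mulNmx opprK; apply.
Qed.

Lemma transvection_prod_cancel n L (b : 'cV[R]_n) (c : 'rV[R]_n) (A : 'M[R]_n) :
  c *m b = 0 -> transvection_prod L ((1%:M + b *m c) *m A) ->
  transvection_prod L.+1 A.
Proof.
move=> cb tA; exists (- b), c, ((1%:M + b *m c) *m A); split=> //.
  by rewrite mulmxN cb oppr0.
by rewrite mulmxA mulNmx transvectionVl // mul1mx.
Qed.

Lemma transvection_prod_block n L (A : 'M[R]_n) :
  transvection_prod L A ->
  transvection_prod L (block_mx 1%:M 0 0 A : 'M_(1 + n)).
Proof.
elim: L A => [|L IH] A /=; first by move->; rewrite -scalar_mx_block.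
move=> [b [c [A' [cb -> /IH tA']]]].
exists (col_mx 0 b), (row_mx 0 c), (block_mx 1%:M 0 0 A'); split=> //.
  by rewrite mul_row_col !(mul0mx, mulmx0, mul1mx, mulmx1, addr0, add0r).
by rewrite mul_col_row scalar_mx_block add_block_mx mulmx_block
  !(mul0mx, mulmx0, mul1mx, mulmx1, addr0, add0r).
Qed.

End TransvectionProd.

Lemma transvection_prod_map (R S : pzRingType) (f : {rmorphism R -> S}) n L
    (A : 'M[R]_n) :
  transvection_prod L A -> transvection_prod L (map_mx f A).
Proof.
elim: L A => [|L IH] A /=; first by move->; rewrite map_mx1.
move=> [b [c [A' [cb -> /IH tA']]]].
exists (map_mx f b), (map_mx f c), (map_mx f A'); split=> //.
  by rewrite -map_mxM cb map_mx0.
by rewrite -!map_mxM -(map_mx1 f) -map_mxD -map_mxM.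
Qed.

(** Sylvester's identity: both sides are the determinant of the block matrix
    with rows (1, - X) and (P, 1), factored in the two possible orders. *)
Lemma det_1addMC (R : comNzRingType) m n (P : 'M[R]_(m, n)) (X : 'M[R]_(n, m)) :
  \det (1%:M + P *m X) = \det (1%:M + X *m P).
Proof.
have e1 : block_mx 1%:M (- X) P 1%:M =
    block_mx 1%:M 0 P 1%:M *m block_mx 1%:M (- X) 0 (1%:M + P *m X) :> 'M_(n + m).
  rewrite mulmx_block !(mul0mx, mulmx0, mul1mx, mulmx1, addr0, add0r).
  by rewrite mulmxN addrCA addNr addr0.
have e2 : block_mx 1%:M (- X) P 1%:M =
    block_mx 1%:M (- X) 0 1%:M *m block_mx (1%:M + X *m P) 0 P 1%:M :> 'M_(n + m).
  rewrite mulmx_block !(mul0mx, mulmx0, mul1mx, mulmx1, addr0, add0r).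
  by rewrite mulNmx addrK.
have := congr1 determinant e2; rewrite e1 !det_mulmx.
by rewrite !det_lblock !det_ublock !det1 !mul1r !mulr1.
Qed.

(** The matrix on the left is M transported along the split injection P and
    extended by the identity on the complement of its image.  Stabilization and
    the passage from 1 x 1 matrices to their entry are both of this kind. *)
Lemma det_retract (R : comNzRingType) m n (P : 'M[R]_(m, n)) (Q : 'M[R]_(n, m))
    (M : 'M[R]_n) :
  Q *m P = 1%:M -> \det (1%:M + P *m (M - 1%:M) *m Q) = \det M.
Proof.
by move=> QP; rewrite -mulmxA det_1addMC -mulmxA QP mulmx1 addrC subrK.
Qed.

(** * Generation of SL_n over a field by transvections *)

Section SpecialLinear.
Variable F : fieldType.

Lemma det_transvection n (b : 'cV[F]_n) (c : 'rV[F]_n) :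
  \det (1%:M + b *m c) = 1 + (c *m b) 0 0.
Proof. by rewrite det_1addMC det_mx11 !mxE. Qed.

(** With 1 in the corner, one transvection clears the first column and another
    the first row, which leaves a smaller matrix of determinant 1. *)
Lemma SL_corner1 n (r : 'rV[F]_n) (v : 'cV[F]_n) (D : 'M[F]_n) :
  (forall A : 'M[F]_n, \det A = 1 -> exists L, transvection_prod L A) ->
  \det (block_mx 1%:M r v D : 'M_(1 + n)) = 1 ->
  exists L, transvection_prod L (block_mx 1%:M r v D : 'M_(1 + n)).
Proof.
move=> IH.
pose e := col_mx 1%:M 0 : 'cV[F]_(1 + n).
pose e' := row_mx 1%:M 0 : 'rV[F]_(1 + n).
pose D' : 'M[F]_n := D - v *m r.
have eM : block_mx 1%:M r v D = (1%:M + col_mx 0 v *m e') *m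
    (block_mx 1%:M 0 0 D' *m (1%:M + e *m row_mx 0 r)) :> 'M_(1 + n).
  rewrite /e /e' !mul_col_row !scalar_mx_block !add_block_mx !mulmx_block.
  rewrite !(mul0mx, mulmx0, mul1mx, mulmx1, addr0, add0r).
  by rewrite /D' addrCA subrr addr0.
have c1 : e' *m col_mx 0 v = 0
  by rewrite mul_row_col !(mul0mx, mulmx0, mul1mx, mulmx1, addr0, add0r).
have c2 : row_mx 0 r *m e = 0
  by rewrite mul_row_col !(mul0mx, mulmx0, mul1mx, mulmx1, addr0, add0r).
rewrite eM !det_mulmx !det_transvection c1 c2 !mxE addr0 mul1r mulr1.
rewrite det_ublock det1 mul1r => /IH[L /transvection_prod_block tD].
exists (1 + (L + 1))%N; apply: transvection_prodM; first exact: transvection_prod1.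
by apply: transvection_prodM => //; apply: transvection_prod1.
Qed.

(** A nonzero entry below the corner allows the corner to be made 1 by adding a
    multiple of its row to the first row. *)
Lemma SL_column_neq0 n (a : 'M[F]_1) (r : 'rV[F]_n) (v : 'cV[F]_n) (D : 'M[F]_n) :
  (forall A : 'M[F]_n, \det A = 1 -> exists L, transvection_prod L A) ->
  v != 0 -> \det (block_mx a r v D : 'M_(1 + n)) = 1 ->
  exists L, transvection_prod L (block_mx a r v D : 'M_(1 + n)).
Proof.
move=> IH /cV0Pn[j vj] dM.
pose w : 'rV[F]_n := ((1 - a 0 0) / v j 0) *: delta_mx 0 j.
have wv : a + w *m v = 1%:M.
  rewrite /w -scalemxAl -rowE; apply/matrixP=> i1 j1; rewrite !ord1 !mxE divfK //.
  by rewrite addrC subrK.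
pose e := col_mx 1%:M 0 : 'cV[F]_(1 + n).
have ce : row_mx 0 w *m e = 0
  by rewrite mul_row_col !(mul0mx, mulmx0, mul1mx, mulmx1, addr0, add0r).
have eM : (1%:M + e *m row_mx 0 w) *m block_mx a r v D =
    block_mx 1%:M (r + w *m D) v D.
  rewrite /e mul_col_row scalar_mx_block add_block_mx mulmx_block.
  by rewrite !(mul0mx, mulmx0, mul1mx, mulmx1, addr0, add0r) wv.
have [|L tL] := @SL_corner1 n (r + w *m D) v D IH.
  by rewrite -eM det_mulmx dM det_transvection ce mxE addr0 mul1r.
by exists L.+1; apply: (transvection_prod_cancel ce); rewrite eM.
Qed.

(** Only a first column that vanishes below the corner remains: adding the first
    row to the others makes it nonzero. *)
Lemma SL_transvection_prod n (A : 'M[F]_n) :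
  \det A = 1 -> exists L, transvection_prod L A.
Proof.
elim: n A => [|[|n] IH] A; first by exists 0%N; rewrite /= (flatmx0 A) [RHS]flatmx0.
  by rewrite det_mx11 => A1; exists 0%N; rewrite [A]mx11_scalar A1.
rewrite -(submxK (A : 'M_(1 + n.+1))).
move: (ulsubmx _) (ursubmx _) (dlsubmx _) (drsubmx _) => a r v D dA.
have [v0|v0] := eqVneq v 0; last exact: SL_column_neq0.
have a0 : a 0 0 != 0.
  apply: contra_eq_neq dA => a0.
  by rewrite v0 [\det _](det_ublock a r D) det_mx11 a0 mul0r eq_sym oner_eq0.
pose u : 'cV[F]_n.+1 := const_mx 1.
pose e : 'rV[F]_(1 + n.+1) := row_mx 1%:M 0.
have ce : e *m col_mx 0 u = 0
  by rewrite mul_row_col !(mul0mx, mulmx0, mul1mx, mulmx1, addr0, add0r).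
have eM : (1%:M + col_mx 0 u *m e) *m block_mx a r v D =
    block_mx a r (u *m a) (u *m r + D).
  rewrite v0 /e mul_col_row scalar_mx_block add_block_mx mulmx_block.
  by rewrite !(mul0mx, mulmx0, mul1mx, mulmx1, addr0, add0r).
have [||L tL] := @SL_column_neq0 n.+1 a r (u *m a) (u *m r + D) IH.
- apply: contraNneq a0 => /matrixP/(_ 0 0).
  by rewrite !mxE big_ord1 mxE mul1r => ->.
- by rewrite -eM det_mulmx dA det_transvection ce mxE addr0 mul1r.
by exists L.+1; apply: (transvection_prod_cancel ce); rewrite eM.
Qed.

End SpecialLinear.

(** * Determinants of matrices over a matricial algebra *)

Section Flattening.
Variables (F : fieldType) (m : nat) (k : 'I_m -> nat).
Local Notation S := (matricial F k).

Lemma matricial_sumE (I : finType) (G : I -> S) i :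
  (\sum_j G j) i = \sum_j G j i.
Proof. by apply: (big_morph (fun a : S => a i)) => [a b|]; rewrite ffunE. Qed.

Definition flatten i n p (A : 'M[S]_(n, p)) :
    'M[F]_(\sum_(q < n) (k i).+1, \sum_(r < p) (k i).+1) :=
  \mxblock_(q < n, r < p) A q r i.

Lemma flattenM i n p q (A : 'M[S]_(n, p)) (B : 'M[S]_(p, q)) :
  flatten i (A *m B) = flatten i A *m flatten i B.
Proof.
rewrite /flatten mul_mxblock; apply/eq_mxblock => a b.
rewrite mxE matricial_sumE; apply: eq_bigr => c _.
by rewrite ffunE.
Qed.

Lemma flattenD i n p (A B : 'M[S]_(n, p)) :
  flatten i (A + B) = flatten i A + flatten i B.
Proof.
by rewrite /flatten -mxblockD; apply/eq_mxblock => a b; rewrite !mxE ffunE.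
Qed.

Lemma flattenN i n p (A : 'M[S]_(n, p)) : flatten i (- A) = - flatten i A.
Proof.
by rewrite /flatten -mxblockN; apply/eq_mxblock => a b; rewrite !mxE ffunE.
Qed.

Lemma flatten1 i n : flatten i (1%:M : 'M[S]_n) = 1%:M.
Proof.
rewrite -(@mxdiagZ F n (fun=> (k i).+1) 1); apply/eq_mxblock => a b.
rewrite mxE; case: eqP => _; last by rewrite mulr0n ffunE.
by rewrite conform_mx_id mulr1n ffunE.
Qed.

Lemma flatten_inj n p (A B : 'M[S]_(n, p)) :
  (forall i, flatten i A = flatten i B) -> A = B.
Proof.
move=> AB; apply/matrixP=> a b; apply/ffunP=> i.
by have := AB i; rewrite /flatten => /eq_mxblockP; apply.
Qed.

Definition mdet i n (A : 'M[S]_n) : F := \det (flatten i A).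

Lemma mdetM i n (A B : 'M[S]_n) : mdet i (A *m B) = mdet i A * mdet i B.
Proof. by rewrite /mdet flattenM det_mulmx. Qed.

Lemma mdet1 i n : mdet i (1%:M : 'M[S]_n) = 1.
Proof. by rewrite /mdet flatten1 det1. Qed.

Lemma mdet_stab i n N (A : 'M[S]_n) : (n <= N)%N -> mdet i (stab N A) = mdet i A.
Proof.
move=> nN; pose P : 'M[S]_(N, n) := pid_mx n; pose Q : 'M[S]_(n, N) := pid_mx n.
have QP : Q *m P = 1%:M by rewrite pid_mx_id // pid_mx_1.
have PQ : P *m Q = pid_mx n by rewrite pid_mx_id.
have -> : stab N A = 1%:M + P *m (A - 1%:M) *m Q.
  rewrite /stab /copid_mx mulmxBr mulmx1 mulmxBl PQ.
  by rewrite addrCA.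
rewrite /mdet !(flattenD, flattenM, flattenN, flatten1).
by apply: det_retract; rewrite -flattenM QP flatten1.
Qed.

Lemma mdet_scalar i (x : S) : mdet i (x%:M : 'M_1) = \det (x i).
Proof.
pose P : 'M[F]_(_, (k i).+1) := \mxcol_(q < 1) 1%:M.
pose Q : 'M[F]_((k i).+1, _) := \mxrow_(q < 1) 1%:M.
(* The size of flatten is a sum with one term, so P and Q are identity
   matrices up to that change of size. *)
have QP : Q *m P = 1%:M by rewrite mul_mxrow_mxcol big_ord1 mul1mx.
have PMQ (M : 'M[F]_((k i).+1)) : P *m M *m Q = \mxblock_(q < 1, r < 1) M.
  rewrite mxcol_mul mul_mxcol_mxrow.
  by apply/eq_mxblock => a b; rewrite mul1mx mulmx1.
have PQ : P *m Q = 1%:M.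
  rewrite -[P in LHS]mulmx1 PMQ -(flatten1 i 1); apply/eq_mxblock => a b.
  by rewrite !ord1 mxE eqxx mulr1n ffunE.
rewrite -(det_retract (x i) QP) mulmxBr mulmx1 mulmxBl PMQ PQ addrC subrK.
apply: (congr1 determinant); apply/eq_mxblock => a b.
by rewrite !ord1 mxE eqxx mulr1n.
Qed.

(** A factorization of each of the flattened matrices is found over F; with a
    common length L, the j-th factors for all i assemble into one factor over S. *)
Lemma SL_matricial_transvection_prod n (A : 'M[S]_n) :
  (forall i, mdet i A = 1) -> exists L, transvection_prod L A.
Proof.
move=> dA; have [L tL] : exists L, forall i, transvection_prod L (flatten i A).
  have /(_ _)/cid tA i := SL_transvection_prod (dA i).
  exists (\max_i sval (tA i)) => i.
  exact: transvection_prod_leq (leq_bigmax i) (svalP (tA i)).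
exists L; elim: L A {dA} tL => [|L IH] A /= tA.
  by apply: flatten_inj => i; rewrite tA flatten1.
have {tA}/all_sig[f tA'] i : {x : 'cV_(\sum_(q < n) (k i).+1) *
    'rV[F]_(\sum_(q < n) (k i).+1) * 'M[F]_(\sum_(q < n) (k i).+1) |
    [/\ x.1.2 *m x.1.1 = 0, flatten i A = (1%:M + x.1.1 *m x.1.2) *m x.2 &
        transvection_prod L x.2]}.
  by apply: cid; have [b [c [A' bcA']]] := tA i; exists (b, c, A').
pose b i := (f i).1.1; pose c i := (f i).1.2; pose A' i := (f i).2.
(* A block of the column b i is itself a column: it is stored as the first
   column of a square block, and dually for rows.  In the product B C these
   paddings meet as the 1 x 1 identity. *)
pose k0 i : 'I_(k i).+1 := ord0.
pose B : 'cV[S]_n := \col_q [ffun i => submxcol (b i) q *m delta_mx 0 (k0 i)].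
pose C : 'rV[S]_n := \row_q [ffun i => delta_mx (k0 i) 0 *m submxrow (c i) q].
pose A1 : 'M[S]_n := \matrix_(q, r) [ffun i => submxblock (A' i) q r].
have fA1 i : flatten i A1 = A' i.
  rewrite -[RHS]submxblockK; apply/eq_mxblock => q r.
  by rewrite mxE ffunE.
exists B, C, A1; split; last by apply: IH => i; rewrite fA1; case: (tA' i).
  apply/matrixP=> q r; apply/ffunP=> i; rewrite !mxE [RHS]ffunE.
  have [cb _ _] := tA' i.
  transitivity (delta_mx (k0 i) 0 *m (c i *m b i) *m delta_mx 0 (k0 i)).
    rewrite -[c i]submxrowK -[b i]submxcolK mul_mxrow_mxcol mulmx_sumr mulmx_suml.
    rewrite [LHS]matricial_sumE; apply: eq_bigr => t _.
    by rewrite [LHS]ffunE !mxE !ffunE -[LHS]/(_ *m _) !mulmxA.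
  by rewrite cb mulmx0 mul0mx.
apply: flatten_inj => i; rewrite flattenM flattenD flatten1 fA1.
have [_ -> _] := tA' i; rewrite -/(b i) -/(c i) -/(A' i); congr ((_ + _) *m _).
rewrite -[b i]submxcolK -[c i]submxrowK mul_mxcol_mxrow.
apply/eq_mxblock => q r; rewrite !mxE big_ord1 !mxE !ffunE.
rewrite -[RHS]mulmxA (mulmxA (delta_mx _ _)) mul_delta_mx.
rewrite (_ : delta_mx 0 0 = 1%:M) ?mul1mx //.
by apply/matrixP=> s t; rewrite !ord1 !mxE.
Qed.

End Flattening.

(** * Quotients and abelianization *)

Section Quotients.
Local Open Scope group_scope.

Lemma quot_proj_eq1 (G : groupType) (N : {pred G}) (hN : normal_subgroup N) x :
  quot_proj hN x = 1 <-> x \in N.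
Proof.
rewrite -[1]/(quot_proj hN 1); split.
  by move=> /esym/quot_projP; rewrite invg1 mul1g.
by move=> xN; apply/esym/quot_projP; rewrite invg1 mul1g.
Qed.

Lemma first_isomorphism (G K : groupType) (N : {pred G})
    (hN : normal_subgroup N) (f : G -> K) (fM : {morph f : x y / x * y}) :
  (forall x, x \in N <-> f x = 1) -> (forall y, exists x, f x = y) ->
  exists phi : {multiplicative quot_group hN -> K},
    bijective phi /\ forall x, phi (quot_proj hN x) = f x.
Proof.
move=> kerf surjf.
have fE x y : quot_proj hN x = quot_proj hN y <-> f x = f y.
  have fxy : f y = f x * f (x^-1 * y) by rewrite -fM mulVKg.
  split=> [/quot_projP/kerf xy1|eq_xy]; first by rewrite fxy xy1 mulg1.
  by apply/quot_projP/kerf; apply: (mulgI (f x)); rewrite -fxy mulg1.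
pose phi (a : quot_group hN) := f (repr a).
have phiE x : phi (quot_proj hN x) = f x.
  by apply/fE; rewrite quot_proj_repr.
have phiM : {morph phi : a b / a * b}.
  move=> a b; rewrite -[a]quot_proj_repr -[b]quot_proj_repr -quot_projM !phiE.
  by rewrite fM.
pose mphi := isMultiplicative.Build _ _ phi phiM.
pose Phi : {multiplicative quot_group hN -> K} := HB.pack phi mphi.
exists Phi; split=> //.
have /choice[g gK] := surjf.
exists (fun y => quot_proj hN (g y)) => [a|y] /=; last by rewrite phiE.
by rewrite -[a]quot_proj_repr; apply/fE; rewrite gK phiE.
Qed.

Lemma to_ab_eq1 (G : groupType) (x : G) :
  to_ab x = 1 <-> x \in @commutator_subgroup G.
Proof. exact: quot_proj_eq1. Qed.

Lemma to_abM (G : groupType) : {morph @to_ab G : x y / x * y}.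
Proof. exact: quot_projM. Qed.

Lemma to_ab_commg (G : groupType) (x y : G) : to_ab [~ x, y] = 1.
Proof. by apply/to_ab_eq1/asboolP => H _; apply. Qed.

End Quotients.

(** * Transvections vanish in K_1 *)

Section K1.
Variable R : pzRingType.

Definition transvection m n (b : 'M[R]_(m, n)) (c : 'M[R]_(n, m))
    (cb : c *m b = 0) : GLn R m :=
  mk_unit (transvectionVr cb) (transvectionVl cb).

(** diag(1 + b c, 1) is the commutator of the elementary matrices with
    off-diagonal blocks - b and - c: the terms in c b that would spoil the
    identity vanish. *)
Lemma GLstab_transvection m n (b : 'M[R]_(m, n)) (c : 'M[R]_(n, m))
    (cb : c *m b = 0) :
  exists x y : GLn R (m + n),
    GLstab (leq_addr n m) (transvection cb) = [~ x, y]%g.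
Proof.
have cb' : row_mx 0 1%:M *m col_mx (- b) 0 = 0 :> 'M[R]_n.
  by rewrite mul_row_col mulmx0 mul0mx addr0.
have cc' : row_mx 1%:M 0 *m col_mx 0 (- c) = 0 :> 'M[R]_m.
  by rewrite mul_row_col mulmx0 mul0mx addr0.
exists (transvection cb'), (transvection cc').
apply/uval_inj; rewrite uval_GLstab stab_block commgEl conjgE.
rewrite !uvalM -![uval (transvection _)^-1%g]/(uinv _) /uval /uinv /=.
rewrite !mul_col_row !scalar_mx_block !opp_block_mx !add_block_mx.
rewrite -![_ * _ in RHS]/(_ *m _) !mulmx_block.
rewrite !(mul0mx, mulmx0, mul1mx, mulmx1, addr0, add0r,
  mulNmx, mulmxN, opprK, oppr0, subr0).
have -> : c *m (1%:M + b *m c) = c.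
  by rewrite mulmxDr mulmx1 mulmxA cb mul0mx addr0.
by rewrite cb subrr mulmx0 oppr0 !(addr0, add0r) mulmx1 addNr.
Qed.

Lemma to_GLV n (x : GLn R n) : to_GL x^-1%g = (to_GL x)^-1%g.
Proof. exact: esym (GLV_to_GL x). Qed.

Lemma to_GL_commg n (x y : GLn R n) :
  to_GL [~ x, y]%g = [~ to_GL x, to_GL y]%g.
Proof. by rewrite !commgEl !conjgE !to_GL_morph !to_GLV. Qed.

Lemma K1_transvection m n (b : 'M[R]_(m, n)) (c : 'M[R]_(n, m))
    (cb : c *m b = 0) :
  to_ab (to_GL (transvection cb)) = 1%g.
Proof.
rewrite -(to_GL_stab (leq_addr n m)); have [x [y ->]] := GLstab_transvection cb.
have -> : to_GL [~ x, y]%g = [~ to_GL x, to_GL y]%g by rewrite to_GL_commg.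
exact: to_ab_commg.
Qed.

Lemma K1_transvection_prod n L (x : GLn R n) :
  transvection_prod L (uval x) -> to_ab (to_GL x) = 1%g.
Proof.
elim: L x => [|L IH] x /=.
  move=> x1; have -> : x = 1%g by apply/uval_inj.
  apply/to_ab_eq1; rewrite to_GL1.
  by case: (commutator_subgroup_normal (GL R)) => -[].
move=> [b [c [A [cb xA tA]]]].
rewrite -[x](mulVKg (transvection cb)) to_GL_morph to_abM K1_transvection mul1g.
apply: IH; rewrite uvalM xA -[_ * _]/(_ *m _) mulmxA.
by rewrite -[uval _^-1%g]/(1%:M - b *m c) transvectionVl // mul1mx.
Qed.

Lemma unit_K1M : {morph @unit_K1 R : x y / (x * y)%g}.
Proof.
by move=> x y; rewrite /unit_K1 /unit_GL1 unit_mapM to_GL_morph to_abM.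
Qed.

End K1.

(** * Units homotopic to 1 *)

Section Homotopy.
Variable R : nzRingType.

Lemma homotopic_to_1P (x : units R) :
  reflect (exists u : units {poly R}, (uval u).[0] = 1 /\ (uval u).[1] = uval x)
    (x \in homotopic_to_1 (R := R)).
Proof. exact: asboolP. Qed.

Lemma homotopic_to_1_1 : 1%g \in homotopic_to_1 (R := R).
Proof. by apply/homotopic_to_1P; exists 1%g; rewrite !hornerC. Qed.

(** Evaluation at the central elements 0 and 1 is multiplicative. *)
Lemma homotopic_to_1M (x y : units R) :
  x \in homotopic_to_1 (R := R) -> y \in homotopic_to_1 (R := R) ->
  (x * y)%g \in homotopic_to_1 (R := R).
Proof.
move=> /homotopic_to_1P[u [u0 u1]] /homotopic_to_1P[v [v0 v1]].
apply/homotopic_to_1P; exists (u * v)%g; rewrite !uvalM.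
rewrite !hornerM_comm ?u0 ?u1 ?v0 ?v1 ?mulr1 //.
- by rewrite /comm_poly mulr1 mul1r.
- by rewrite /comm_poly mulr0 mul0r.
Qed.

Lemma unipotentVr (S : pzRingType) (x : S) :
  x * x = 0 -> (1 + x) * (1 - x) = 1.
Proof. by move=> xx; rewrite mulrDl mul1r mulrBr mulr1 xx subr0 subrK. Qed.

Lemma unipotentVl (S : pzRingType) (x : S) :
  x * x = 0 -> (1 - x) * (1 + x) = 1.
Proof. by move=> xx; rewrite mulrDr mulr1 mulrBl mul1r xx subr0 subrK. Qed.

(** The path is t |-> 1 + t n. *)
Lemma homotopic_to_1_unipotent (x : units R) (n : R) :
  n * n = 0 -> uval x = 1 + n -> x \in homotopic_to_1 (R := R).
Proof.
move=> nn xE; pose p := n%:P * 'X.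
have pp : p * p = 0.
  by rewrite /p -mulrA (mulrA 'X) -commr_polyX mulrA mulrA -polyCM nn !mul0r.
apply/homotopic_to_1P; exists (mk_unit (unipotentVr pp) (unipotentVl pp)).
by rewrite -[uval _]/(1 + p) /p !hornerE xE.
Qed.

Lemma homotopic_to_1_transvection_prod L (x : units R) :
  transvection_prod L ((uval x)%:M : 'M_1) -> x \in homotopic_to_1 (R := R).
Proof.
elim: L x => [|L IH] x /=.
  move=> /matrixP/(_ 0 0); rewrite !mxE mulr1n => x1.
  have -> : x = 1%g by apply/uval_inj.
  exact: homotopic_to_1_1.
move=> [b [c [A [cb xA tA]]]]; pose n := b 0 0 * c 0 0.
have nn : n * n = 0.
  have /matrixP/(_ 0 0) := cb; rewrite !mxE big_ord1 => cb0.
  by rewrite /n mulrA -(mulrA (b 0 0)) cb0 mulr0 mul0r.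
pose t := mk_unit (unipotentVr nn) (unipotentVl nn); rewrite -[x](mulVKg t).
apply: homotopic_to_1M; first exact: (homotopic_to_1_unipotent nn).
apply: IH; rewrite uvalM (_ : uval x = (1 + n) * A 0 0).
  by rewrite mulrA -[uval t^-1%g]/(1 - n) unipotentVl // mul1r -mx11_scalar.
by have /matrixP/(_ 0 0) := xA; rewrite !mxE big_ord1 !mxE big_ord1 mulr1n.
Qed.

End Homotopy.

(** * Exhaustion by unital matricial subalgebras *)

Record unital_embedding (F : fieldType) (R : pzRingType) := UnitalEmbedding {
  emb_num : nat;
  emb_dim : 'I_emb_num -> nat;
  emb_map :> {rmorphism matricial F emb_dim -> R};
  emb_inj : injective emb_map
}.

Definition eventually (P : nat -> Prop) :=
  exists s0, forall s, (s0 <= s)%N -> P s.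

Lemma eventually_forall (I : finType) (P : I -> nat -> Prop) :
  (forall i, eventually (P i)) -> eventually (fun s => forall i, P i s).
Proof.
move=> /choice[t tP]; exists (\max_i t i) => s ts i.
by apply: tP; apply: leq_trans ts; apply: leq_bigmax.
Qed.

Lemma eventually_and (P Q : nat -> Prop) :
  eventually P -> eventually Q -> eventually (fun s => P s /\ Q s).
Proof.
move=> [s sP] [t tQ]; exists (maxn s t) => r; rewrite geq_max => /andP[sr tr].
by split; [apply: sP | apply: tQ].
Qed.

Lemma eventuallyS (P Q : nat -> Prop) :
  (forall s, P s -> Q s) -> eventually P -> eventually Q.
Proof. by move=> PQ [s sP]; exists s => t /sP/PQ. Qed.

Lemma eventually_ex P : eventually P -> exists s, P s.
Proof. by move=> [s sP]; exists s; apply: sP. Qed.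

(** As soon as a subalgebra contains 1, injectivity of its parametrization makes
    the preimage of 1 the identity, so the parametrization is unital; the
    exhaustion therefore starts at a stage that contains 1. *)
Lemma ultramatricial_exhaustion (F : fieldType) (R : algType F) :
  ultramatricial R -> exists e : nat -> unital_embedding F R,
    forall x, eventually (fun s => exists a, e s a = x).
Proof.
move=> [S [matS SS exhS]]; have [N S1] := exhS 1.
have S_le s t x : (s <= t)%N -> S s x -> S t x.
  by move=> /subnK <- Ssx; elim: (t - s)%N => // r; apply: SS.
have /choice[e eP] s : exists e : unital_embedding F R,
    forall x, S (N + s)%N x -> exists a, e a = x.
  have [m [k [f [fM f_inj fS]]]] := matS (N + s)%N.
  have [a fa] : exists a, f a = 1 by apply/fS; apply: S_le S1; apply: leq_addr.
  have f1 : f 1 = 1.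
    by rewrite -fa; congr (f _); apply: f_inj; rewrite -[a in RHS]mulr1 fM fa mul1r.
  pose mf := GRing.isMonoidMorphism.Build _ _ f (conj f1 fM).
  pose g : {rmorphism matricial F k -> R} := HB.pack (f : _ -> _) f mf.
  by exists (@UnitalEmbedding F R m k g f_inj) => x /fS.
exists e => x; have [s Ssx] := exhS x; exists s => t st.
by apply: eP; apply: S_le Ssx; apply: leq_trans st (leq_addl _ _).
Qed.

Section Stage.
Variables (F : fieldType) (R : nzRingType) (e : unital_embedding F R).
Local Notation S := (matricial F (emb_dim (u := e))).

Definition defined_over n p (A : 'M[R]_(n, p)) :=
  exists A' : 'M[S]_(n, p), map_mx e A' = A.

Definition special_over n (A : 'M[R]_n) :=
  exists2 A' : 'M[S]_n, map_mx e A' = A & forall i, mdet i A' = 1.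

Lemma map_emb_inj n p : injective (map_mx e : 'M[S]_(n, p) -> 'M[R]_(n, p)).
Proof.
move=> A B /matrixP AB; apply/matrixP=> i j; apply: (@emb_inj _ _ e).
by have := AB i j; rewrite !mxE.
Qed.

Lemma map_emb_stab n N (A : 'M[S]_n) : map_mx e (stab N A) = stab N (map_mx e A).
Proof.
by rewrite /stab /copid_mx map_mxD map_mxB !map_mxM map_mx1 !map_pid_mx.
Qed.

Lemma special_over1 n : special_over (1%:M : 'M_n).
Proof. by exists 1%:M => [|i]; rewrite ?map_mx1 ?mdet1. Qed.

Lemma special_overM n (A B : 'M[R]_n) :
  special_over A -> special_over B -> special_over (A *m B).
Proof.
move=> [A' <- dA] [B' <- dB]; exists (A' *m B') => [|i]; first by rewrite map_mxM.
by rewrite mdetM dA dB mulr1.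
Qed.

Lemma mdet_inverse n (A B : 'M[S]_n) i :
  map_mx e A *m map_mx e B = 1%:M -> mdet i A * mdet i B = 1.
Proof.
by rewrite -map_mxM -(map_mx1 e) => /map_emb_inj AB; rewrite -mdetM AB mdet1.
Qed.

Lemma special_overV n (A B : 'M[R]_n) :
  A *m B = 1%:M -> special_over A -> defined_over B -> special_over B.
Proof.
move=> AB [A' eA dA] [B' eB]; exists B' => // i.
by have := @mdet_inverse n A' B' i; rewrite eA eB AB dA mul1r; apply.
Qed.

Lemma special_over_stab n N (A : 'M[R]_n) :
  (n <= N)%N -> special_over A -> special_over (stab N A).
Proof.
move=> nN [A' <- dA]; exists (stab N A') => [|i]; first by rewrite map_emb_stab.
by rewrite mdet_stab.
Qed.

(** The determinants are those of any lift of A, because lifts are unique. *)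
Lemma special_over_unstab n N (A : 'M[R]_n) :
  (n <= N)%N -> defined_over A -> special_over (stab N A) -> special_over A.
Proof.
move=> nN [A' eA] [B eB dB]; exists A' => // i.
rewrite -(mdet_stab i A' nN); suff -> : stab N A' = B by [].
by apply: map_emb_inj; rewrite map_emb_stab eA eB.
Qed.

Lemma special_over_transvection_prod n (A : 'M[R]_n) :
  special_over A -> exists L, transvection_prod L A.
Proof.
move=> [A' <- /SL_matricial_transvection_prod[L tA]].
by exists L; apply: transvection_prod_map.
Qed.

Lemma special_over_commg n (x y : GLn R n) :
  defined_over (uval x) -> defined_over (uinv x) ->
  defined_over (uval y) -> defined_over (uinv y) ->
  special_over (uval [~ x, y]%g).
Proof.
move=> [a ea] [a' ea'] [b eb] [b' eb'].
exists (a' *m (b' *m (a *m b))) => [|i].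
  by rewrite !map_mxM ea ea' eb eb' commgEl conjgE.
have da : mdet i a * mdet i a' = 1.
  by apply: mdet_inverse; rewrite ea ea'; apply: (uvalV x).
have db : mdet i b * mdet i b' = 1.
  by apply: mdet_inverse; rewrite eb eb'; apply: (uvalV y).
rewrite !mdetM mulrA mulrACA [_ * mdet i a]mulrC [_ * mdet i b]mulrC.
by rewrite da db mulr1.
Qed.

End Stage.

(** * Special matrices are those trivial in K_1 *)

Section Exhaustion.
Variables (F : fieldType) (R : nzRingType) (e : nat -> unital_embedding F R).
Hypothesis e_exhaust : forall x, eventually (fun s => exists a, e s a = x).

Lemma defined_over_eventually n p (A : 'M[R]_(n, p)) :
  eventually (fun s => defined_over (e s) A).
Proof.
have := eventually_forall (fun ij : 'I_n * 'I_p => e_exhaust (A ij.1 ij.2)).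
apply: eventuallyS => s /choice[a aA]; exists (\matrix_(i, j) a (i, j)).
by apply/matrixP=> i j; rewrite !mxE aA.
Qed.

Lemma special_over_K1 s n (x : GLn R n) :
  special_over (e s) (uval x) -> to_ab (to_GL x) = 1%g.
Proof.
by move=> /special_over_transvection_prod[L]; apply: K1_transvection_prod.
Qed.

(** Requiring the property at all large stages, and not only at some stage, makes
    it stable under products without comparing the determinants of one
    stage with those of the next. *)
Definition eventually_special (g : GL R) := exists n (x : GLn R n),
  g = to_GL x /\ eventually (fun s => special_over (e s) (uval x)).

Lemma eventually_special_group_closed :
  group_closed (fun g : GL R => `[< eventually_special g >]).
Proof.
split.
  apply/asboolP; exists 0%N, 1%g; split=> //.
  by exists 0%N => s _; apply: special_over1.
move=> _ _ /asboolP[n [x [-> sx]]] /asboolP[p [y [-> sy]]]; apply/asboolP.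
have xN := leq_maxl n p; have yN := leq_maxr n p.
exists (maxn n p), (GLstab xN x * (GLstab yN y)^-1)%g; split.
  by rewrite to_GL_morph to_GLV !to_GL_stab.
have := defined_over_eventually (uinv (GLstab yN y)).
move=> /(eventually_and sy)/(eventually_and sx).
apply: eventuallyS => s [{}sx [{}sy dy]].
rewrite uvalM; apply: special_overM; first exact: special_over_stab.
by apply: (special_overV (uvalV (GLstab yN y)) _ dy); apply: special_over_stab.
Qed.

Lemma GL_common (g h : GL R) :
  exists n (x y : GLn R n), g = to_GL x /\ h = to_GL y.
Proof.
exists (maxn (tag (repr g)) (tag (repr h))).
have [x gx] := GL_lift (leq_maxl (tag (repr g)) (tag (repr h))).
have [y hy] := GL_lift (leq_maxr (tag (repr g)) (tag (repr h))).
by exists x, y.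
Qed.

Lemma eventually_special_commg (g h : GL R) : eventually_special [~ g, h]%g.
Proof.
have [n [x [y [-> ->]]]] := GL_common g h.
exists n, [~ x, y]%g; split; first by rewrite to_GL_commg.
have dx := defined_over_eventually (uval x).
have dx' := defined_over_eventually (uinv x).
have dy := defined_over_eventually (uval y).
have dy' := defined_over_eventually (uinv y).
have := eventually_and dx (eventually_and dx' (eventually_and dy dy')).
by apply: eventuallyS => s [? [? []]]; apply: special_over_commg.
Qed.

Lemma K1_special_over n (x : GLn R n) :
  to_ab (to_GL x) = 1%g -> exists s, special_over (e s) (uval x).
Proof.
have commH g h : [~ g, h]%g \in (fun g : GL R => `[< eventually_special g >]).
  exact/asboolP/eventually_special_commg.
move=> /to_ab_eq1/asboolP/(_ _ eventually_special_group_closed commH)/asboolP.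
move=> [p [y [/to_GLP[N [nN pN xy]] sy]]].
have := eventually_and sy (defined_over_eventually (uval x)).
move=> /eventually_ex[s [{}sy dx]]; exists s.
by apply: (special_over_unstab nN dx); rewrite xy; apply: special_over_stab.
Qed.

Lemma special_over_homotopic s (x : units R) :
  special_over (e s) ((uval x)%:M : 'M_1) -> x \in homotopic_to_1 (R := R).
Proof.
move=> /special_over_transvection_prod[L].
exact: homotopic_to_1_transvection_prod.
Qed.

End Exhaustion.

(** * Polynomials over a matricial algebra *)

Section CoefficientMatrices.
Variables (F : fieldType) (m : nat) (k : 'I_m -> nat) (i : 'I_m).
Local Notation S := (matricial F k).

(** The i-th component of the polynomial with coefficients a 0, ..., a (d - 1).
    It is given by its coefficients because a matricial algebra may be the zero
    ring, whereas polynomials are formed over nontrivial rings. *)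
Definition coef_mx (d : nat) (a : nat -> S) : 'M[{poly F}]_((k i).+1) :=
  \matrix_(q, r) \poly_(j < d) a j i q r.

Lemma coef_mxE d (a : nat -> S) q r t :
  (forall j, (d <= j)%N -> a j = 0) -> (coef_mx d a q r)`_t = a t i q r.
Proof.
move=> a0; rewrite mxE coef_poly; case: ltnP => // /a0 ->.
by rewrite ffunE mxE.
Qed.

(** The hypothesis on convolutions says that the polynomials with coefficients a
    and b have product 1. *)
Lemma coef_mx_mul_eq1 d (a b : nat -> S) :
  (forall j, (d <= j)%N -> a j = 0) -> (forall j, (d <= j)%N -> b j = 0) ->
  (forall t, \sum_(j < t.+1) a j * b (t - j)%N = (t == 0)%:R) ->
  coef_mx d a *m coef_mx d b = 1%:M.
Proof.
move=> a0 b0 ab; apply/matrixP=> q r; apply/polyP=> t.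
have -> : (1%:M : 'M[{poly F}]_((k i).+1)) q r = ((q == r)%:R : F)%:P.
  by rewrite mxE polyC_natr.
have := congr1 (fun x : S => x i q r) (ab t); rewrite matricial_sumE summxE => abt.
rewrite coefC mxE coef_sum.
transitivity (\sum_(j < t.+1) (a j * b (t - j)%N) i q r).
  under eq_bigr do rewrite coefM; rewrite exchange_big; apply: eq_bigr => j _.
  by rewrite ffunE mxE; apply: eq_bigr => z _; rewrite !coef_mxE.
rewrite abt; case: t {abt} => [|t]; first by rewrite ffunE mxE.
by rewrite !ffunE mxE.
Qed.

Lemma horner_coef_mx0 d (a : nat -> S) : (forall j, (d <= j)%N -> a j = 0) ->
  map_mx (horner_eval 0) (coef_mx d a) = a 0%N i.
Proof.
by move=> a0; apply/matrixP=> q r; rewrite mxE /horner_eval horner_coef0 coef_mxE.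
Qed.

Lemma horner_coef_mx1 d (a : nat -> S) :
  map_mx (horner_eval 1) (coef_mx d a) = (\sum_(j < d) a j) i.
Proof.
apply/matrixP=> q r; rewrite !mxE /horner_eval horner_poly matricial_sumE summxE.
by apply: eq_bigr => j _; rewrite expr1n mulr1.
Qed.

(** The determinant of an invertible matrix over F[t] is a unit of F[t], that is,
    a constant. *)
Lemma det_horner_const n (A B : 'M[{poly F}]_n) x y : A *m B = 1%:M ->
  \det (map_mx (horner_eval x) A) = \det (map_mx (horner_eval y) A).
Proof.
move=> AB; rewrite !det_map_mx /= !horner_evalE.
have /eqP : size (\det A * \det B) = 1%N by rewrite -det_mulmx AB det1 size_poly1.
rewrite size_mul_eq1 => /andP[/size_poly1P[c _ ->] _].
by rewrite !hornerC.
Qed.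

End CoefficientMatrices.

(** * The kernel and the image of the map from units to K_1 *)

Section Main.
Variables (F : fieldType) (R : nzRingType) (e : nat -> unital_embedding F R).
Hypothesis e_exhaust : forall x, eventually (fun s => exists a, e s a = x).

Lemma lift_coefs s d (p : {poly R}) : (size p <= d)%N ->
  defined_over (e s) (\row_(j < d) p`_j) ->
  exists a : nat -> matricial F (emb_dim (u := e s)),
    (forall j, e s (a j) = p`_j) /\ (forall j, (d <= j)%N -> a j = 0).
Proof.
move=> pd [A /matrixP eA].
exists (fun j => if insub j is Some j' then A 0 j' else 0).
split=> j.
  case: insubP => [j' _ <-|]; first by have := eA 0 j'; rewrite !mxE.
  by rewrite -leqNgt => dj; rewrite rmorph0 nth_default // (leq_trans pd).
by case: insubP => // j' jd _; rewrite leqNgt jd.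
Qed.

(** Component by component, det u(t) is a constant polynomial, so
    det u(1) = det u(0) = 1. *)
Lemma homotopic_special_over (x : units R) :
  x \in homotopic_to_1 (R := R) ->
  exists s, special_over (e s) ((uval x)%:M : 'M_1).
Proof.
move=> /homotopic_to_1P[u [u0 u1]].
pose d := maxn (size (uval u)) (size (uinv u)).
have ud : (size (uval u) <= d)%N by apply: leq_maxl.
have vd : (size (uinv u) <= d)%N by apply: leq_maxr.
have dv := defined_over_eventually e_exhaust (\row_(j < d) (uinv u)`_j).
have du := defined_over_eventually e_exhaust (\row_(j < d) (uval u)`_j).
have [s [/(lift_coefs ud)[a [ea a0]] /(lift_coefs vd)[b [eb b0]]]] :=
  eventually_ex (eventually_and du dv).
have ab t : \sum_(j < t.+1) a j * b (t - j)%N = (t == 0)%:R.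
  apply: (@emb_inj _ _ (e s)); rewrite rmorph_sum rmorph_nat.
  rewrite -[RHS](coef1 R t) -(uvalV u) coefM; apply: eq_bigr => j _.
  by rewrite rmorphM ea eb.
have a_0 : a 0%N = 1.
  by apply: (@emb_inj _ _ (e s)); rewrite ea rmorph1 -horner_coef0.
exists s, ((\sum_(j < d) a j)%:M) => [|i].
  rewrite map_scalar_mx /= rmorph_sum -u1 (horner_coef_wide _ ud).
  by congr (_%:M); apply: eq_bigr => j _; rewrite ea expr1n mulr1.
rewrite mdet_scalar -horner_coef_mx1.
rewrite (det_horner_const _ 0 (coef_mx_mul_eq1 i a0 b0 ab)) horner_coef_mx0 //.
by rewrite a_0 ffunE det1.
Qed.

Lemma homotopic_to_1_K1 (x : units R) :
  x \in homotopic_to_1 (R := R) <-> unit_K1 x = 1%g.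
Proof.
split=> [/homotopic_special_over[s]|/(K1_special_over e_exhaust)[s]].
  exact: (@special_over_K1 F R e s 1 (unit_GL1 x)).
exact: special_over_homotopic.
Qed.

Lemma homotopic_to_1_normal : normal_subgroup (homotopic_to_1 (R := R)).
Proof.
have u1 : unit_K1 (1%g : units R) = 1%g by apply/homotopic_to_1_K1/homotopic_to_1_1.
split; first split; first exact: homotopic_to_1_1.
  move=> x y /homotopic_to_1_K1 xE /homotopic_to_1_K1 yE; apply/homotopic_to_1_K1.
  rewrite unit_K1M xE mul1g; apply: (mulIg (unit_K1 y)).
  by rewrite -unit_K1M mulVg u1 yE mulg1.
move=> x y /homotopic_to_1_K1 xE; apply/homotopic_to_1_K1.
by rewrite conjgE !unit_K1M xE mul1g -unit_K1M mulVg.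
Qed.

Definition diag_det (k : nat) (a : F) : 'M[F]_(1 + k) :=
  block_mx a%:M 0 0 1%:M.

Lemma diag_detM k a b : diag_det k a *m diag_det k b = diag_det k (a * b).
Proof.
rewrite /diag_det mulmx_block !(mulmx0, mul0mx, mulmx1, addr0, add0r).
by rewrite -scalar_mxM.
Qed.

Lemma det_diag_det k a : \det (diag_det k a) = a.
Proof. by rewrite /diag_det det_ublock det_scalar1 det1 mulr1. Qed.

Lemma diag_det1 k : diag_det k 1 = 1%:M.
Proof. by rewrite /diag_det -scalar_mx_block. Qed.

(** At a stage that contains A and its inverse, the determinants of A are
    invertible; the unit x that has them as determinants satisfies A = x modulo
    special matrices. *)
Lemma unit_K1_surj (y : K1 R) : exists x : units R, unit_K1 x = y.
Proof.
have [n [A ->]] : exists n (A : GLn R n.+1), y = to_ab (to_GL A).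
  have [A gA] := GL_lift (leqnSn (tag (repr (repr y)))).
  exists (tag (repr (repr y))), A.
  by rewrite -gA -[LHS]quot_proj_repr.
have := defined_over_eventually e_exhaust (uinv A).
move=> /(eventually_and (defined_over_eventually e_exhaust (uval A))).
move=> /eventually_ex[s [[B eB] [B' eB']]].
have dBB' i : mdet i B * mdet i B' = 1.
  by apply: mdet_inverse; rewrite eB eB'; apply: (uvalV A).
pose z : matricial F (emb_dim (u := e s)) := [ffun i => diag_det _ (mdet i B)].
pose z' : matricial F (emb_dim (u := e s)) := [ffun i => diag_det _ (mdet i B')].
have zz' : z * z' = 1.
  by apply/ffunP=> i; rewrite !ffunE -[LHS]/(_ *m _) diag_detM dBB' diag_det1.
have z'z : z' * z = 1.
  by apply/ffunP=> i; rewrite !ffunE -[LHS]/(_ *m _) diag_detM mulrC dBB' diag_det1.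
have fM u v : u * v = 1 -> e s u * e s v = 1.
  by move=> uv; rewrite -rmorphM uv rmorph1.
pose x := mk_unit (fM _ _ zz') (fM _ _ z'z).
exists x; pose X := GLstab (isT : (1 <= n.+1)%N) (unit_GL1 x).
have: to_ab (to_GL (X^-1 * A)%g) = 1%g.
  apply: (@special_over_K1 F R e s).
  exists (stab n.+1 (z'%:M : 'M_1) *m B) => [|i].
    by rewrite map_mxM map_emb_stab map_scalar_mx eB.
  by rewrite mdetM mdet_stab // mdet_scalar ffunE det_diag_det mulrC.
move=> /(congr1 (fun w => to_ab (to_GL X) * w)%g).
by rewrite mulg1 -to_abM -to_GL_morph mulVKg /X to_GL_stab.
Qed.

End Main.

Theorem theorem1p7 (l : fieldType) (R : algType l) :
  ultramatricial R ->
  exists hN : normal_subgroup (homotopic_to_1 (R := R)),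
  exists phi : {multiplicative quot_group hN -> K1 R},
    bijective phi /\ forall x : units R, phi (quot_proj hN x) = unit_K1 x.
Proof.
move=> /ultramatricial_exhaustion[e e_exhaust].
exists (homotopic_to_1_normal e_exhaust).
apply: first_isomorphism; first exact: unit_K1M.
  exact: homotopic_to_1_K1.
exact: unit_K1_surj.
Qed.
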